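(* Let $m\geq 3.6\times 10^9$ be a positive integer. Then every graph $G$ with exactly $m$ edges and $\lambda(G)>\sqrt{m}$ contains at least $\frac{m^2}{2000}$ copies of 4-cycles (equivalently, $f(m)\geq \frac{m^2}{2000}$), unless $G$ is a star (possibly with some isolated vertices).
   Context: Graphs are finite, simple and undirected. $\lambda(G)$ is the spectral radius of $G$, i.e. the largest eigenvalue of its adjacency matrix. The number of copies of 4-cycles in $G$ is the number of (not necessarily induced) subgraphs of $G$ isomorphic to the cycle $C_4$ on four vertices. $f(m)$ is the minimum number of copies of 4-cycles over all (labelled) graphs $G$ with $m$ edges and $\lambda(G)>\sqrt{m}$. A star is a graph $K_{1,m}$. *)

(* Defs.v *)
From HB Require Import structures.
From mathcomp Require Import all_boot all_order all_algebra.
From mathcomp Require Import boolp classical_sets reals.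
Set Implicit Arguments.
Unset Strict Implicit.
Unset Printing Implicit Defensive.
Import Order.TTheory GRing.Theory Num.Theory.
Local Open Scope ring_scope.

Record sgraph := SGraph {
  vertex :> finType;
  adj : rel vertex;
  adj_sym : symmetric adj;
  adj_irr : irreflexive adj }.

Definition edges (G : sgraph) : {set {set G}} :=
  [set A : {set G} | [exists x, exists y, adj x y && (A == [set x; y])]].

Lemma cycle_adj_sym n :
  symmetric (fun i j : 'I_n => (i != j) && ((j == ordS i) || (i == ordS j))).
Proof. by move=> i j; rewrite eq_sym orbC. Qed.

Lemma cycle_adj_irr n :
  irreflexive (fun i j : 'I_n => (i != j) && ((j == ordS i) || (i == ordS j))).
Proof. by move=> i; rewrite eqxx. Qed.

(* [ordS] is the successor modulo [n]; this is the cycle C_n for n >= 3. *)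
Definition cycle_graph (n : nat) : sgraph :=
  SGraph (@cycle_adj_sym n) (@cycle_adj_irr n).

Lemma star_adj_sym m :
  symmetric (fun x y : option 'I_m => (x == None) != (y == None)).
Proof. by move=> x y; rewrite eq_sym. Qed.

Lemma star_adj_irr m :
  irreflexive (fun x y : option 'I_m => (x == None) != (y == None)).
Proof. by move=> x; rewrite eqxx. Qed.

(* K_{1,m}: [None] is the centre and the [Some i] are the leaves. *)
Definition star_graph (m : nat) : sgraph :=
  SGraph (@star_adj_sym m) (@star_adj_irr m).

Definition star_with_isolated (G : sgraph) : Prop :=
  exists k : nat, exists h : star_graph k -> G,
    injective h /\ edges G = [set h @: A | A : {set star_graph k} in edges (star_graph k)].

(* A pair [S] of a vertex set and an edge set. *)
Definition subgraph (G : sgraph) (S : {set G} * {set {set G}}) : bool :=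
  (S.2 \subset edges G) && [forall A in S.2, A \subset S.1].

Definition isom_subgraph (H G : sgraph) (S : {set G} * {set {set G}}) : bool :=
  [exists h : {ffun H -> G},
    [&& injectiveb h, S.1 == h @: [set: H]
      & S.2 == [set h @: A | A : {set H} in edges H]]].

Definition copies (H G : sgraph) : nat :=
  #|[set S : {set G} * {set {set G}} | subgraph S && isom_subgraph H S]|.

Definition adjmx (R : realType) (G : sgraph) : 'M[R]_#|G| :=
  \matrix_(i, j) (adj (enum_val i) (enum_val j))%:R.

(* The set of real eigenvalues is finite, and nonempty when [G] has a vertex
   (a real symmetric matrix), so this supremum is the largest eigenvalue. *)
Definition lambda (R : realType) (G : sgraph) : R :=
  sup [set a : R | eigenvalue (adjmx R G) a]%classic.

(* The infimum of a nonempty set of natural numbers is its minimum; the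
   infimum of the empty set is 0. *)
Definition f (R : realType) (m : nat) : R :=
  inf [set r : R | exists G : sgraph,
    [/\ #|edges G| = m, Num.sqrt m%:R < lambda R G
      & r = (copies (cycle_graph 4) G)%:R]]%classic.

(* Main.v *)
Require Import Defs.
From mathcomp Require Import all_boot all_order all_algebra.
From mathcomp Require Import boolp classical_sets reals.
From mathcomp Require Import ring lra zify.
Import Order.TTheory GRing.Theory Num.Theory.
Local Open Scope ring_scope.

(** Let [G] have [m] edges and let [v] be an eigenvector of its adjacency
    matrix [A] for an eigenvalue [a > sqrt m]. Then [G] has at least
    [m^2 / 2000] copies of the 4-cycle; the exceptional case of stars is empty,
    since a star has spectral radius exactly [sqrt m]. Write [c(x,y)] for the
    number of common neighbours of [x] and [y]. The sum of [c (c - 1)] over the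
    ordered pairs of distinct vertices counts the labelled 4-cycles, hence is
    at most 8 times the number [C] of copies ([labelled_C4_le_copies]).

    No vertex [u] has degree above [4m/5] ([dominant_vertex_bound]). Otherwise
    only [t = m - deg u < m/5] edges miss [u]. Let [d] be the degree function of
    [G - u] and [d2(x)] the sum of [d] over the neighbours of [x] in [G - u].
    With [s = sqrt m], put [z(u) = s] and
    [z(x) = 1 + 5/3 (d(x)/s + d2(x)/s^2)] for the other vertices. The sums of
    [d] and [d2] over [G - u] are at most [2t] and [2t^2], which gives
    [A z <= s z]; as [z] is positive, no eigenvalue of [A] exceeds [s].

    If all degrees are at most [4m/5] and [C < m^2/2000], then [v] vanishes
    ([labelled_C4_lower_bound]). Let [L] be the set of vertices of degree at
    least [m/1000]; it has at most 2000 elements. For [u] in [L], the row [u] of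
    [A^2 v = a^2 v] reads [(a^2 - deg u) v(u) = sum of c(u,w) v(w) over w != u],
    where [a^2 - deg u >= m/5]. The squares of the coefficients, summed over
    these rows, make at most [8 C + 4000 m], so [v] has at most 1/9 of its
    squared norm [|v|^2] on [L]. For [x] outside [L], the equation
    [a v(x) = (A v)(x)] splits [v] into its part on [L], on which [A] acts
    with squared norm at most [2m] (the squared Frobenius norm of [A]), and its
    part outside [L], on which the adjacency matrix [B] of [G - L] acts with
    squared norm at most [m/10]: the squared Frobenius norm of [B^2] is bounded
    by [8 C] plus twice the sum of the squared degrees outside [L]
    ([restricted_adj_norm]). The squared norm of [v] outside [L] would then
    be at most 5 times the one on [L], hence at most [5/9 |v|^2] instead of
    [8/9 |v|^2].

    The bound on [f] also needs one graph with [m] edges and spectral radius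
    above [sqrt m]: a largest possible clique, with the remaining edges placed
    on other vertices ([exists_large_lambda]). *)

(** * The Cauchy-Schwarz inequality *)

Lemma sqr_sum_mul_le (R : realFieldType) (I : finType) (P : pred I)
    (F H : I -> R) :
  (\sum_(i | P i) F i * H i) ^+ 2 <=
  (\sum_(i | P i) F i ^+ 2) * (\sum_(i | P i) H i ^+ 2).
Proof.
have: 0 <= \sum_(i | P i) \sum_(j | P j) (F i * H j - F j * H i) ^+ 2.
  by do 2![apply: sumr_ge0 => ? _]; exact: sqr_ge0.
under eq_bigr => i _.
  under eq_bigr => j _.
    have -> : (F i * H j - F j * H i) ^+ 2 =
      F i ^+ 2 * H j ^+ 2 + F j ^+ 2 * H i ^+ 2 - 2 * (F i * H i * (F j * H j)).
      by ring.
    over.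
  rewrite sumrB big_split /= -!mulr_sumr -mulr_suml; over.
rewrite sumrB big_split /= -!mulr_suml -!mulr_sumr -mulr_suml.
set X := \sum_(i | P i) F i ^+ 2; set Y := \sum_(i | P i) H i ^+ 2.
set Z := \sum_(i | P i) F i * H i => h; nra.
Qed.

(** * Adjacency, degrees and common neighbours *)

(** The entry of the adjacency matrix at a pair of vertices. *)
Definition adjr (R : realFieldType) (G : sgraph) (x y : G) : R :=
  (adj x y)%:R.

(** The degree of a vertex, as an element of [R]. *)
Definition degr (R : realFieldType) (G : sgraph) (x : G) : R :=
  \sum_y adjr R G x y.

(** The number of common neighbours of [x] and [y] that lie in [S]. *)
Definition codeg (G : sgraph) (S : pred G) (x y : G) : nat :=
  #|[pred z | [&& S z, adj x z & adj z y]]|.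

Arguments adjr R {G} x y.
Arguments degr R {G} x.
Arguments codeg {G} S x y.

Lemma adjrC (R : realFieldType) (G : sgraph) (x y : G) : adjr R x y = adjr R y x.
Proof. by rewrite /adjr adj_sym. Qed.

Lemma adjr_ge0 (R : realFieldType) (G : sgraph) (x y : G) : 0 <= adjr R x y.
Proof. exact: ler0n. Qed.

Lemma adjr_le1 (R : realFieldType) (G : sgraph) (x y : G) : adjr R x y <= 1.
Proof. by rewrite lern1 leq_b1. Qed.

Lemma adjr_idem (R : realFieldType) (G : sgraph) (x y : G) :
  adjr R x y * adjr R x y = adjr R x y.
Proof. by rewrite /adjr; case: adj; rewrite ?mulr1 ?mulr0. Qed.

Lemma adjrxx (R : realFieldType) (G : sgraph) (x : G) : adjr R x x = 0.
Proof. by rewrite /adjr adj_irr. Qed.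

Lemma codegE (R : realFieldType) (G : sgraph) (S : pred G) (x y : G) :
  (codeg S x y)%:R = \sum_(z | S z) adjr R x z * adjr R z y.
Proof.
rewrite /codeg -sum1_card natr_sum big_mkcond [RHS]big_mkcond /=.
apply: eq_bigr => z _; rewrite inE /adjr.
by case: (S z); case: (adj x z); case: (adj z y); rewrite /= ?mulr1 ?mulr0.
Qed.

Lemma codegxx (R : realFieldType) (G : sgraph) (x : G) :
  (codeg predT x x)%:R = degr R x.
Proof.
rewrite (codegE R); apply: eq_bigr => z _.
by rewrite (adjrC R G z x) adjr_idem.
Qed.

Lemma sub_codeg (G : sgraph) (S : pred G) (x y : G) :
  (codeg S x y <= codeg predT x y)%N.
Proof. by apply/subset_leq_card/fintype.subsetP => z; rewrite !inE => /and3P[_ -> ->]. Qed.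

Lemma degr_ge0 (R : realFieldType) (G : sgraph) (x : G) : 0 <= degr R x.
Proof. by apply: sumr_ge0 => y _; exact: adjr_ge0. Qed.

(** When [c] is a number of common neighbours, the first summand counts the
    labelled 4-cycles with a given diagonal, and the second one is summed over
    all pairs by means of degrees. *)
Lemma sqrn_split (R : realFieldType) (c : nat) :
  c%:R ^+ 2 = (c * c.-1)%:R + c%:R :> R.
Proof. by case: c => [|c]; rewrite ?muln0 ?expr0n ?addr0 //= -natrX -natrD; congr _%:R; lia. Qed.

(** The number of labelled 4-cycles of [G]: choose the ends [x] and [y] of a
    diagonal, then two distinct common neighbours of them in order. *)
Definition labelled_C4 (R : realFieldType) (G : sgraph) : R :=
  \sum_(x : G) \sum_(y | y != x) (codeg predT x y * (codeg predT x y).-1)%:R.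

(** * Norm of the adjacency matrix of an induced subgraph *)

(** The left-hand side is the squared Frobenius norm of [B^2], where [B] is the
    adjacency matrix of the subgraph induced on [S]. The diagonal of [B^2] and
    the linear part [c] of [c^2 = c (c - 1) + c] each contribute at most the sum
    of the squared degrees. *)
Lemma sum_codeg_sqr (R : realFieldType) (G : sgraph) (S : pred G) :
  \sum_(x | S x) \sum_(y | S y) (codeg S x y)%:R ^+ 2 <=
  labelled_C4 R G + 2 * \sum_(x | S x) degr R x ^+ 2.
Proof.
have diag x : S x ->
    \sum_(y | S y) (codeg S x y)%:R ^+ 2 <=
    degr R x ^+ 2
    + \sum_(y | y != x) (codeg predT x y * (codeg predT x y).-1)%:R
    + \sum_(y | S y) (codeg S x y)%:R.
  move=> Sx; rewrite (bigD1 x) //= -addrA lerD //.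
    rewrite -codegxx ler_pXn2r ?nnegrE ?ler0n //.
    by rewrite ler_nat sub_codeg.
  apply: (@le_trans _ _ (\sum_(y | S y && (y != x))
     ((codeg predT x y * (codeg predT x y).-1)%:R + (codeg S x y)%:R))).
    apply: ler_sum => y _; rewrite sqrn_split lerD2r ler_nat.
    have := @sub_codeg G S x y; set c := codeg _ _ _; set c' := codeg _ _ _.
    by move=> cc; rewrite leq_mul //; lia.
  rewrite big_split /= lerD //.
    rewrite big_mkcond [leRHS]big_mkcond /=; apply: ler_sum => y _.
    by case: (S y) => //=; case: ifP.
  rewrite big_mkcond [leRHS]big_mkcond /=; apply: ler_sum => y _.
  by case: (S y) => //=; case: ifP.
apply: (le_trans (ler_sum _ diag)).
rewrite !big_split /= -addrA addrCA lerD //.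
  rewrite /labelled_C4 [leRHS](bigID S) /= lerDl.
  by do 2![apply: sumr_ge0 => ? _].
rewrite mulrDl !mul1r lerD2l.
under eq_bigr => x _ do under eq_bigr => y _ do rewrite (codegE R).
under eq_bigr => x _ do rewrite exchange_big /=.
rewrite exchange_big /=; apply: ler_sum => z Sz.
under eq_bigr => x _ do rewrite -mulr_sumr.
rewrite -mulr_suml expr2 ler_pM //; try by apply: sumr_ge0 => ? _; exact: adjr_ge0.
  rewrite big_mkcond; apply: ler_sum => x _.
  by rewrite (adjrC R G x); case: ifP => // _; exact: adjr_ge0.
rewrite big_mkcond; apply: ler_sum => x _.
by case: ifP => // _; exact: adjr_ge0.
Qed.

(** With [B] as above, [|B v|^2 = <v, B^2 v>] is at most [|v|^2] times the
    Frobenius norm of [B^2]. *)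
Lemma restricted_adj_norm (R : realFieldType) (G : sgraph) (S : pred G)
    (v : G -> R) (k : R) :
  0 <= k -> labelled_C4 R G + 2 * (\sum_(x | S x) degr R x ^+ 2) <= k ^+ 2 ->
  \sum_(x | S x) (\sum_(y | S y) adjr R x y * v y) ^+ 2 <=
  k * \sum_(x | S x) v x ^+ 2.
Proof.
move=> k0 hk; set Y := \sum_(x | S x) v x ^+ 2; set Q := \sum_(x | S x) _.
have Y0 : 0 <= Y by apply: sumr_ge0 => ? _; exact: sqr_ge0.
have Q0 : 0 <= Q by apply: sumr_ge0 => ? _; exact: sqr_ge0.
have QE : Q = \sum_(y | S y) v y * \sum_(z | S z) (codeg S y z)%:R * v z.
  under eq_bigr => y _ do rewrite mulr_sumr.
  under eq_bigr => y _ do under eq_bigr => z _ do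
    rewrite (codegE R) mulrCA mulr_suml mulrC.
  transitivity (\sum_(x | S x) \sum_(y | S y) \sum_(z | S z)
      (adjr R x y * v y) * (adjr R x z * v z)).
    apply: eq_bigr => x _; rewrite expr2 mulr_suml.
    by apply: eq_bigr => y _; rewrite mulr_sumr.
  rewrite exchange_big /=; apply: eq_bigr => y _.
  rewrite exchange_big /=; apply: eq_bigr => z _.
  by apply: eq_bigr => x _; rewrite (adjrC R G y x); ring.
have Q2 : Q ^+ 2 <= Y * \sum_(y | S y) (\sum_(z | S z) (codeg S y z)%:R * v z) ^+ 2.
  by rewrite {1}QE sqr_sum_mul_le.
have F2 : \sum_(y | S y) (\sum_(z | S z) (codeg S y z)%:R * v z) ^+ 2 <=
    k ^+ 2 * Y.
  apply: (@le_trans _ _ ((\sum_(x | S x) \sum_(y | S y) (codeg S x y)%:R ^+ 2) * Y)).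
    by rewrite mulr_suml; apply: ler_sum => y _; exact: sqr_sum_mul_le.
  by rewrite ler_wpM2r // (le_trans (sum_codeg_sqr _ _ _)).
rewrite -(@ler_pXn2r _ 2) ?nnegrE ?mulr_ge0 //.
by apply: (le_trans Q2); rewrite exprMn [Y ^+ 2]expr2 mulrCA ler_wpM2l //; nra.
Qed.

(** * Eigenvectors as functions on the vertices *)

(** [v] is an eigenvector of the adjacency matrix of [G] for [a], seen as a
    nonzero function on the vertices rather than as a row indexed by ordinals. *)
Definition eigenpair (R : realFieldType) (G : sgraph) (a : R) (v : G -> R) :=
  (forall x, \sum_y adjr R x y * v y = a * v x) /\ exists x, v x != 0.
Arguments eigenpair {R G} a v.

Lemma sum_sqr_gt0 (R : realFieldType) (T : finType) (v : T -> R) (x : T) :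
  v x != 0 -> 0 < \sum_y v y ^+ 2.
Proof.
move=> vx; rewrite (bigD1 x) //= ltr_pwDl //.
  by rewrite lt0r sqr_ge0 sqrf_eq0 vx.
by apply: sumr_ge0 => y _; exact: sqr_ge0.
Qed.

(** A Perron-Frobenius test: [A |v| >= a |v|] entrywise, so pairing with [z]
    gives [a <z, |v|> <= <A z, |v|> <= s <z, |v|>]. *)
Lemma eigenpair_le_supersolution (R : realFieldType) (G : sgraph) (a s : R)
    (v z : G -> R) :
  eigenpair a v -> (forall x, 0 < z x) ->
  (forall x, \sum_y adjr R x y * z y <= s * z x) -> a <= s.
Proof.
move=> [Av [x0 vx0]] z0 Az.
have vz0 : 0 < \sum_x z x * `|v x|.
  rewrite (bigD1 x0) //= ltr_pwDl ?mulr_gt0 ?normr_gt0 //.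
  by apply: sumr_ge0 => y _; rewrite mulr_ge0 // ltW.
rewrite -(ler_pM2r vz0) !mulr_sumr.
apply: (@le_trans _ _ (\sum_x \sum_y z x * (adjr R x y * `|v y|))).
  apply: ler_sum => x _; rewrite mulrCA -mulr_sumr ler_wpM2l ?(ltW (z0 x)) //.
  apply: (@le_trans _ _ `|a * v x|).
    by rewrite normrM ler_wpM2r // ler_norm.
  rewrite -Av; apply: (le_trans (ler_norm_sum _ _ _)); apply: ler_sum => y _.
  by rewrite normrM (ger0_norm (adjr_ge0 _ _ _ _)).
rewrite exchange_big /=; apply: ler_sum => y _.
under eq_bigr => x _ do rewrite mulrA -(adjrC R G y) [z x * _]mulrC.
by rewrite -mulr_suml mulrA ler_wpM2r.
Qed.

(** The row [x] of [A^2 v = a^2 v], with the diagonal entry [deg x] of [A^2]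
    moved to the left. *)
Lemma eigenpair_sqr (R : realFieldType) (G : sgraph) (a : R) (v : G -> R) x :
  eigenpair a v ->
  (a ^+ 2 - degr R x) * v x = \sum_(y | y != x) (codeg predT x y)%:R * v y.
Proof.
move=> [Av _].
have A2 : \sum_y (codeg predT x y)%:R * v y = a ^+ 2 * v x.
  under eq_bigr => y _ do rewrite (codegE R) mulr_suml.
  rewrite exchange_big /= expr2 -mulrA -Av mulr_sumr; apply: eq_bigr => z _.
  under eq_bigr => y _ do rewrite -mulrA.
  by rewrite -mulr_sumr Av mulrCA.
by move: A2; rewrite (bigD1 x) //= codegxx mulrBl => <-; rewrite addrAC subrr add0r.
Qed.

(** * Graphs without a dominant vertex *)

Lemma card_high_degree (R : realFieldType) (G : sgraph) (m k : R) :
  0 < m -> 0 < k -> \sum_(x : G) degr R x <= 2 * m ->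
  (#|[pred x : G | m <= k * degr R x]|)%:R <= 2 * k.
Proof.
move=> m0 k0 hdeg; rewrite -(ler_pM2r m0).
apply: (@le_trans _ _ (k * \sum_(x : G) degr R x)); last by nra.
rewrite mulr_natl -sumr_const mulr_sumr big_mkcond; apply: ler_sum => x _.
by rewrite inE; case: ifP => // _; rewrite mulr_ge0 ?degr_ge0 // ltW.
Qed.

(** If all degrees are at most [4m/5], an eigenvalue above [sqrt m] forces many
    4-cycles. *)
Lemma labelled_C4_lower_bound (R : realFieldType) (G : sgraph) (a m : R) (v : G -> R) :
  36 / 10 * 10 ^+ 9 <= m -> m < a ^+ 2 -> eigenpair a v ->
  \sum_(x : G) degr R x <= 2 * m ->
  (forall x : G, degr R x <= 4 / 5 * m) ->
  m ^+ 2 / 250 <= labelled_C4 R G.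
Proof.
move=> hm ha ev hdeg dmax; rewrite leNgt; apply/negP => hC.
have m0 : 0 < m by lra.
pose L := [pred x : G | m <= 1000 * degr R x].
have cL : (#|L|)%:R <= 2000 :> R.
  by have := @card_high_degree R G m 1000 m0 (ltr0Sn _ _) hdeg; lra.
have [Av [x0 vx0]] := ev.
set X := \sum_x v x ^+ 2.
have X0 : 0 < X by exact: sum_sqr_gt0 vx0.
pose XL := \sum_(x | L x) v x ^+ 2; pose XS := \sum_(x | ~~ L x) v x ^+ 2.
have XE : X = XL + XS by rewrite /X (bigID L).
have XL0 : 0 <= XL by apply: sumr_ge0 => ? _; exact: sqr_ge0.
have XS0 : 0 <= XS by apply: sumr_ge0 => ? _; exact: sqr_ge0.
(* The rows of [A^2 v = a^2 v] at the vertices of [L]: the factor [m / 5] is a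
   lower bound for [a^2 - deg x], and [4000 m] bounds the linear part
   of the sums of squares, at most [2 m] for each of at most 2000 rows. *)
have hL : (m / 5) ^+ 2 * XL <= (m ^+ 2 / 250 + 4000 * m) * X.
  apply: (@le_trans _ _ ((labelled_C4 R G + 4000 * m) * X)); last first.
    by rewrite ler_wpM2r ?ltW //; lra.
  apply: (@le_trans _ _ (\sum_(x | L x)
      ((\sum_(y | y != x) (codeg predT x y * (codeg predT x y).-1)%:R)
       + \sum_(y : G) degr R y) * X)).
    rewrite /XL mulr_sumr; apply: ler_sum => x _.
    apply: (@le_trans _ _ (((a ^+ 2 - degr R x) * v x) ^+ 2)).
      rewrite [leRHS]exprMn ler_wpM2r ?sqr_ge0 //.
      by rewrite ler_pXn2r ?nnegrE //; have := dmax x; lra.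
    rewrite (eigenpair_sqr R G a v x ev); apply: (le_trans (sqr_sum_mul_le _ _ _ _ _)).
    rewrite ler_pM //; try by apply: sumr_ge0 => ? _; exact: sqr_ge0.
      rewrite (eq_bigr _ (fun y _ => sqrn_split R (codeg predT x y))) big_split /=.
      rewrite lerD2l big_mkcond; apply: ler_sum => y _.
      case: ifP => _; last exact: degr_ge0.
      rewrite (codegE R); apply: ler_sum => z _.
      by rewrite (adjrC R G z y) ler_piMl ?adjr_ge0 ?adjr_le1.
    by rewrite /X [leRHS](bigD1 x) //= lerDr sqr_ge0.
  rewrite -mulr_suml ler_wpM2r ?(ltW X0) // big_split /= lerD //.
    rewrite /labelled_C4 [leRHS](bigID L) /= lerDl.
    by do 2![apply: sumr_ge0 => ? _].
  have D0 : 0 <= \sum_(y : G) degr R y by apply: sumr_ge0 => ? _; exact: degr_ge0.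
  apply: (@le_trans _ _ ((#|L|)%:R * \sum_(y : G) degr R y)).
    by rewrite mulr_natl -sumr_const.
  by have := ler_pM (ler0n _ _) D0 cL hdeg; lra.
(* The squared Frobenius norm of the adjacency matrix is the sum of the
   degrees. *)
have hA : \sum_x (\sum_(y | L y) adjr R x y * v y) ^+ 2 <= 2 * m * XL.
  apply: (@le_trans _ _ (\sum_x degr R x * XL)).
    apply: ler_sum => x _; apply: (le_trans (sqr_sum_mul_le _ _ _ _ _)).
    rewrite ler_wpM2r // big_mkcond; apply: ler_sum => y _.
    by rewrite expr2 adjr_idem; case: ifP => // _; exact: adjr_ge0.
  by rewrite -mulr_suml ler_wpM2r.
have hB : \sum_(x | ~~ L x) (\sum_(y | ~~ L y) adjr R x y * v y) ^+ 2 <=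
    m / 10 * XS.
  apply: restricted_adj_norm; first by lra.
  have : \sum_(x | ~~ L x) degr R x ^+ 2 <= m / 1000 * (2 * m).
    apply: (@le_trans _ _ (m / 1000 * \sum_x degr R x)); last first.
      by rewrite ler_wpM2l //; lra.
    rewrite mulr_sumr big_mkcond; apply: ler_sum => x _.
    have := degr_ge0 R G x; case: ifP => [|_]; last by nra.
    by rewrite -ltNge => h d0; rewrite expr2 ler_wpM2r //; lra.
  by move: hC (sqr_ge0 m) => *; lra.
(* The eigenvalue equation outside [L], split by [(p + q)^2 <= 2 p^2 + 2 q^2]. *)
have hS : m * XS <= 2 * (2 * m * XL) + 2 * (m / 10 * XS).
  apply: (@le_trans _ _ (a ^+ 2 * XS)); first by rewrite ler_wpM2r // ltW.
  apply: (@le_trans _ _ (\sum_(x | ~~ L x)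
     (2 * (\sum_(y | L y) adjr R x y * v y) ^+ 2 +
      2 * (\sum_(y | ~~ L y) adjr R x y * v y) ^+ 2))).
    rewrite /XS mulr_sumr; apply: ler_sum => x _; rewrite -exprMn -Av (bigID L) /=.
    set p := \sum_(y | m <= _) _; set q := \sum_(y | ~~ _) _.
    by have := sqr_ge0 (p - q); lra.
  rewrite big_split /= -!mulr_sumr lerD // ler_wpM2l //.
  apply: le_trans hA; rewrite big_mkcond; apply: ler_sum => x _.
  by case: ifP => // _; exact: sqr_ge0.
have hL' : XL <= X / 9.
  have m5 : 0 < (m / 5) ^+ 2 by rewrite exprn_gt0 // divr_gt0.
  rewrite -(ler_pM2l m5) (le_trans hL) // [X / 9]mulrC mulrA.
  by rewrite ler_wpM2r ?(ltW X0) //; nra.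
have : 8 / 10 * XS <= 4 * XL by rewrite -(ler_pM2l m0); lra.
by move: X0 XE; lra.
Qed.

(** * Graphs with a dominant vertex *)

(** If some vertex has degree above [4m/5], every eigenvalue is at most
    [sqrt m]. *)
Lemma dominant_vertex_bound (R : realFieldType) (G : sgraph) (a m s : R)
    (v : G -> R) (u : G) :
  10 <= s -> s ^+ 2 = m -> eigenpair a v ->
  \sum_(x : G) degr R x <= 2 * m -> 4 / 5 * m < degr R u -> a <= s.
Proof.
move=> s10 sE ev hdeg hu; have s0 : 0 < s by lra.
have m0 : 0 < m by rewrite -sE exprn_gt0.
pose t := m - degr R u.
(* [W f x] sums [f] over the neighbours of [x] other than [u]. For [x != u],
   [d1 x], [d2 x] and [d3 x] thus count the walks of length 1, 2 and 3 in [G - u]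
   that start at [x]. *)
pose W f (x : G) := \sum_(y | y != u) adjr R x y * f y : R.
pose d1 := W (fun=> 1); pose d2 := W d1; pose d3 := W d2.
have W0 f : (forall x, 0 <= f x) -> forall x, 0 <= W f x.
  by move=> f0 x; apply: sumr_ge0 => y _; rewrite mulr_ge0 ?adjr_ge0.
have d10 : forall x, 0 <= d1 x by apply: W0 => x; exact: ler01.
have d20 : forall x, 0 <= d2 x by exact: W0.
have d1E x : degr R x = adjr R x u + d1 x.
  rewrite /degr (bigD1 u) //=; congr (_ + _).
  by apply: eq_bigr => y _; rewrite mulr1.
have sd1 : \sum_(x | x != u) d1 x <= 2 * t.
  have : \sum_(x : G) degr R x = degr R u + degr R u + \sum_(x | x != u) d1 x.
    rewrite (bigD1 u) //= -addrA; congr (_ + _).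
    under eq_bigr => x _ do rewrite d1E.
    rewrite big_split /=; congr (_ + _).
    rewrite /degr [RHS](bigD1 u) //= adjrxx add0r.
    by apply: eq_bigr => x _; rewrite adjrC.
  by rewrite /t; lra.
(* An edge of [G - u] at [y] is counted once in [d1 y] and once at its other
   end. *)
have d1t y : y != u -> d1 y <= t.
  move=> yu; suff : d1 y + d1 y <= 2 * t by lra.
  apply: le_trans sd1; rewrite [leRHS](bigD1 y) //= lerD2l.
  rewrite /d1 /W (bigD1 y) //= adjrxx mul0r add0r.
  apply: ler_sum => x /andP[xu xy].
  rewrite (bigD1 y) //= (adjrC R G y x) lerDl.
  by apply: sumr_ge0 => z _; rewrite mulr1 adjr_ge0.
have t0 : 0 <= t.
  have : 0 <= \sum_(x | x != u) d1 x by apply: sumr_ge0.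
  by lra.
have d2t x : d2 x <= 2 * t.
  apply: le_trans sd1; apply: ler_sum => y _.
  by rewrite ler_piMl ?adjr_le1.
have d3t x : d3 x <= 2 * t * d1 x.
  rewrite /d3 /d1 /W mulr_sumr; apply: ler_sum => y _.
  by rewrite mulr1 mulrC ler_wpM2r ?adjr_ge0.
have sd2 : \sum_(x | x != u) d2 x <= 2 * t ^+ 2.
  rewrite /d2 /W exchange_big /=.
  apply: (@le_trans _ _ (\sum_(x | x != u) t * d1 x)); last first.
    by rewrite -mulr_sumr; nra.
  apply: ler_sum => y yu; rewrite -mulr_suml ler_wpM2r //.
  apply: le_trans (d1t y yu); rewrite /d1 /W.
  by apply: ler_sum => x _; rewrite mulr1 adjrC.
have s2 : s ^+ 2 != 0 by rewrite sE gt_eqF.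
(* The factor 5/3 is the solution of [alpha (1 - 2/5) = 1], where [2/5] bounds
   [2 t / m]: it makes [z] a supersolution at the vertices other than [u]. *)
pose g x := 5 / 3 * (d1 x / s + d2 x / s ^+ 2).
have g0 x : 0 <= g x.
  by rewrite /g mulr_ge0 ?addr_ge0 ?divr_ge0 // ltW // sE.
pose z x := if x == u then s else 1 + g x.
apply: (eigenpair_le_supersolution R G a s v z ev) => x.
  by rewrite /z; case: eqP => // _; rewrite ltr_pwDl.
have -> : \sum_y adjr R x y * z y =
    adjr R x u * s + d1 x + 5 / 3 * (d2 x / s + d3 x / s ^+ 2).
  rewrite (bigD1 u) //= {1}/z eqxx -addrA; congr (_ + _).
  have -> : d1 x = \sum_(y | y != u) adjr R x y * 1 by [].
  have -> : d2 x = \sum_(y | y != u) adjr R x y * d1 y by [].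
  have -> : d3 x = \sum_(y | y != u) adjr R x y * d2 y by [].
  rewrite !mulr_suml -big_split /= mulr_sumr -big_split /=.
  apply: eq_bigr => y yu; rewrite /z (negbTE yu) /g.
  by field; rewrite gt_eqF.
rewrite {}/z; case: eqP => [->|/eqP xu].
  rewrite adjrxx mul0r add0r.
  (* At [u], the sums range over its neighbours only; those of [d1] and [d2] are
     bounded by the sums over all vertices of [G - u]. *)
  have -> : d1 u = degr R u by rewrite d1E adjrxx add0r.
  have h2 : d2 u <= 2 * t by [].
  have h3 : d3 u <= 2 * t ^+ 2.
    apply: le_trans sd2; rewrite /d3 /W; apply: ler_sum => y _.
    by rewrite ler_piMl ?adjr_le1.
  have e2 : d2 u / s <= t / 5.
    by rewrite ler_pdivrMr //; nra.
  have e3 : d3 u / s ^+ 2 <= 2 / 5 * t.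
    rewrite ler_pdivrMr ?sE //; have : 5 * t <= m by rewrite /t; lra.
    by nra.
  by move: e2 e3; rewrite -expr2 sE /t; lra.
have h3 : d3 x / s ^+ 2 <= 2 / 5 * d1 x.
  rewrite ler_pdivrMr ?sE //.
  have : 5 * t <= m by rewrite /t; lra.
  by have := d3t x; have := d10 x; nra.
have -> : s * (1 + g x) = s + 5 / 3 * d1 x + 5 / 3 * (d2 x / s).
  by rewrite /g; field; rewrite gt_eqF.
have : adjr R x u * s <= s by rewrite ler_piMl ?adjr_le1 ?ltW.
by move: h3; lra.
Qed.

(** * Double counting of edges and of 4-cycles *)

Lemma card_le_fibres (T U : finType) (P : {set T}) (Q : {set U}) (h : T -> U)
    (k : nat) :
  (forall x, x \in P -> h x \in Q) ->
  (forall x, x \in P -> (#|[pred y in P | h y == h x]| <= k)%N) ->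
  (#|P| <= k * #|Q|)%N.
Proof.
move=> hPQ fib; rewrite -sum1_card (partition_big h (mem Q)) //=.
rewrite mulnC -sum_nat_const; apply: leq_sum => q _.
case: (pickP [pred x in P | h x == q]) => [x /andP[/= xP /eqP <-]|none].
  by rewrite sum1_card; exact: fib.
by rewrite big_pred0.
Qed.

Lemma eq_set2 (T : finType) (a b c d : T) :
  [set a; b] = [set c; d] -> (a = c /\ b = d) \/ (a = d /\ b = c).
Proof.
move=> /setP e; have := e a; have := e b; have := e c; have := e d.
rewrite !inE !eqxx ?orbT /=.
move=> /orP[]/eqP h1 /orP[]/eqP h2 /esym/orP[]/eqP h3 /esym/orP[]/eqP h4;
  subst; tauto.
Qed.

Lemma in_edges (G : sgraph) (x y : G) : adj x y -> [set x; y] \in edges G.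
Proof.
by move=> xy; rewrite inE; apply/existsP; exists x; apply/existsP; exists y;
  rewrite xy eqxx.
Qed.

(** The inequality of the handshake lemma that the bounds above require. *)
Lemma sum_degr_le (R : realFieldType) (G : sgraph) :
  \sum_(x : G) degr R x <= 2 * (#|edges G|)%:R.
Proof.
pose P := [set p : G * G | adj p.1 p.2].
have -> : \sum_(x : G) degr R x = (#|P|)%:R.
  rewrite -sum1_card natr_sum pair_big big_mkcond /= [RHS]big_mkcond /=.
  by apply: eq_bigr => -[x y] _; rewrite inE /adjr; case: adj.
rewrite -natrM ler_nat.
apply: (@card_le_fibres _ _ _ _ (fun p => [set p.1; p.2])) => -[x y].
  by rewrite inE => /in_edges.
move=> _; apply: leq_trans (card_size [:: (x, y); (y, x)]).
apply/subset_leq_card/fintype.subsetP => -[a b]; rewrite !inE => /andP[_ /eqP].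
by move=> /= /eq_set2[] [-> ->]; rewrite !xpair_eqE !eqxx ?orbT.
Qed.

(** The labelled 4-cycles: [((a, c), (b, d))] stands for the cycle [a b c d],
    given by its two diagonals. The other distinctness conditions follow from
    the irreflexivity of adjacency. *)
Definition quads (G : sgraph) : {set (G * G) * (G * G)} :=
  [set t | [&& t.1.2 != t.1.1, t.2.2 != t.2.1, adj t.1.1 t.2.1,
     adj t.2.1 t.1.2, adj t.1.1 t.2.2 & adj t.2.2 t.1.2]].

Lemma labelled_C4_quads (R : realFieldType) (G : sgraph) :
  labelled_C4 R G = (#|quads G|)%:R.
Proof.
rewrite /labelled_C4 pair_big_dep /= -sum1_card natr_sum.
rewrite (eq_bigr (fun p : G * G =>
  (codeg predT p.1 p.2 * (codeg predT p.1 p.2).-1)%:R)) //.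
rewrite -!natr_sum; congr _%:R.
rewrite (eq_bigl (fun t : (G * G) * (G * G) => (t.1.2 != t.1.1) &&
  [&& t.2.2 != t.2.1, adj t.1.1 t.2.1,
     adj t.2.1 t.1.2, adj t.1.1 t.2.2 & adj t.2.2 t.1.2])); last first.
  by move=> t; rewrite inE.
rewrite -(pair_big_dep (fun p : G * G => p.2 != p.1) (fun (p : G * G) (q : G * G) =>
   [&& q.2 != q.1, adj p.1 q.1, adj q.1 p.2, adj p.1 q.2 & adj q.2 p.2])
   (fun _ _ => 1%N)) /=.
apply: eq_bigr => -[a c] /= ac.
set N := [pred z | adj a z && adj z c].
have -> : codeg predT a c = #|N| by apply: eq_card => z; rewrite !inE.
rewrite (eq_bigl (fun q : G * G => (q.1 \in N) && ((q.2 != q.1) && (q.2 \in N)))); last first.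
  by move=> -[b d]; rewrite !inE /=; do !case: (adj _ _); case: (d != b).
rewrite -(pair_big_dep (mem N) (fun b d => (d != b) && (d \in N)) (fun _ _ => 1%N)) /=.
rewrite -sum_nat_const; apply: eq_bigr => b bN.
rewrite (cardD1 b) bN add1n /= -sum1_card.
by apply: eq_bigl => d; rewrite !inE.
Qed.

(** The vertex and edge sets of the 4-cycle [a b c d]. *)
Definition quad_support (G : sgraph) (t : (G * G) * (G * G)) :
    {set G} * {set {set G}} :=
  let: ((a, c), (b, d)) := t in
  ([set a; b; c; d], [set [set a; b]; [set b; c]; [set c; d]; [set d; a]]).

Lemma quad_support_copy (G : sgraph) (t : (G * G) * (G * G)) :
  t \in quads G ->
  quad_support G t \in
  [set S : {set G} * {set {set G}} | subgraph S && isom_subgraph (cycle_graph 4) S].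
Proof.
case: t => -[a c] [b d]; rewrite inE /= => /and5P[ca db ab bc /andP[ad dc]].
have cd : adj c d by rewrite adj_sym.
have da : adj d a by rewrite adj_sym.
have adjN (x y : G) : adj x y -> x != y by case: eqVneq => // ->; rewrite adj_irr.
have ac : a != c by rewrite eq_sym.
have bd : b != d by rewrite eq_sym.
rewrite inE /quad_support; apply/andP; split.
  apply/andP; split; rewrite /=.
    by apply/fintype.subsetP => A; rewrite !finset.in_setU !finset.in_set1 -!orbA
      => /or4P[]/eqP->; apply: in_edges.
  apply/forall_inP => A; rewrite !inE -!orbA => /or4P[]/eqP->;
    by apply/fintype.subsetP => x; rewrite !inE => /orP[]/eqP->; rewrite eqxx ?orbT.
pose h := [ffun i : cycle_graph 4 => nth a [:: a; b; c; d] i].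
apply/existsP; exists h; apply/and3P; split.
- apply/injectiveP => i j; rewrite !ffunE => /eqP.
  rewrite nth_uniq //=; first by move/eqP/val_inj.
  by rewrite !inE !negb_or ac bd !adjN.
- apply/eqP/setP => x; apply/idP/imsetP => /=.
    rewrite !inE -!orbA => /or4P[]/eqP->.
    + by exists (Ordinal (isT : (0 < 4)%N)); rewrite ?ffunE.
    + by exists (Ordinal (isT : (1 < 4)%N)); rewrite ?ffunE.
    + by exists (Ordinal (isT : (2 < 4)%N)); rewrite ?ffunE.
    + by exists (Ordinal (isT : (3 < 4)%N)); rewrite ?ffunE.
  by case=> -[[|[|[|[|//]]]] hi] _ ->; rewrite ffunE /= !inE eqxx ?orbT.
apply/eqP/setP => A; apply/idP/imsetP => /=.
  rewrite !inE -!orbA => /or4P[]/eqP->.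
  + exists [set Ordinal (isT : (0 < 4)%N); Ordinal (isT : (1 < 4)%N)].
      exact: (@in_edges (cycle_graph 4)).
    by rewrite imsetU1 imset_set1 !ffunE.
  + exists [set Ordinal (isT : (1 < 4)%N); Ordinal (isT : (2 < 4)%N)].
      exact: (@in_edges (cycle_graph 4)).
    by rewrite imsetU1 imset_set1 !ffunE.
  + exists [set Ordinal (isT : (2 < 4)%N); Ordinal (isT : (3 < 4)%N)].
      exact: (@in_edges (cycle_graph 4)).
    by rewrite imsetU1 imset_set1 !ffunE.
  + exists [set Ordinal (isT : (3 < 4)%N); Ordinal (isT : (0 < 4)%N)].
      exact: (@in_edges (cycle_graph 4)).
    by rewrite imsetU1 imset_set1 !ffunE.
case=> B; rewrite inE => /existsP[i /existsP[j /andP[ij /eqP ->]]] ->.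
rewrite imsetU1 imset_set1 !ffunE !inE.
move: i j ij => -[[|[|[|[|//]]]] hi] [[|[|[|[|//]]]] hj] //= _;
  by rewrite ?eqxx ?orbT // finset.setUC ?eqxx ?orbT.
Qed.

(** A 4-cycle has 8 labellings: the first edge can be any of the 4 edges, in
    either direction, and determines the rest. *)
Lemma card_quad_fibre (G : sgraph) (t : (G * G) * (G * G)) :
  t \in quads G ->
  (#|[pred t' in quads G | quad_support G t' == quad_support G t]| <= 8)%N.
Proof.
have adjN (x y : G) : adj x y -> x <> y by move=> + e; rewrite e adj_irr.
case: t => -[a c] [b d]; rewrite inE /=.
move=> /and5P[/eqP ca /eqP db /adjN ab /adjN bc /andP[/adjN ad /adjN dc]].
apply: leq_trans (card_size [::
  ((a, c), (b, d)); ((a, c), (d, b)); ((c, a), (b, d)); ((c, a), (d, b));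
  ((b, d), (a, c)); ((b, d), (c, a)); ((d, b), (a, c)); ((d, b), (c, a))]).
apply/subset_leq_card/fintype.subsetP => -[[a' c'] [b' d']].
rewrite inE => /andP[]; rewrite inE /=.
move=> /and5P[/eqP ca' /eqP db' /adjN ab' /adjN bc' /andP[/adjN ad' /adjN dc']].
rewrite xpair_eqE => /andP[_ /eqP/setP e].
have := e [set a'; b']; have := e [set b'; c']; have := e [set c'; d'].
rewrite !inE !eqxx ?orbT /= => /esym e3 /esym e2 /esym e1.
move: e1; rewrite -!orbA => /or4P[]/eqP/eq_set2[] [? ?]; subst a' b';
move: e2; rewrite -!orbA => /or4P[]/eqP/eq_set2[] [? ?];
  try (exfalso; congruence); subst c';
move: e3; rewrite -!orbA => /or4P[]/eqP/eq_set2[] [? ?];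
  try (exfalso; congruence); subst d';
by rewrite ?inE !eqxx ?orbT.
Qed.

Lemma labelled_C4_le_copies (R : realFieldType) (G : sgraph) :
  labelled_C4 R G <= 8 * (copies (cycle_graph 4) G)%:R.
Proof.
rewrite labelled_C4_quads -natrM ler_nat.
apply: (@card_le_fibres _ _ _ _ (quad_support G)) => t tq.
  exact: quad_support_copy.
exact: card_quad_fibre.
Qed.

(** * The spectral radius as a supremum of eigenvalues *)

Lemma eigenvalue_adjmxP (R : realType) (G : sgraph) (a : R) :
  eigenvalue (adjmx R G) a <-> exists v : G -> R, eigenpair a v.
Proof.
split.
  case/eigenvalueP => w Aw w0; exists (fun x => w 0 (enum_rank x)); split.
    move=> x; have /rowP/(_ (enum_rank x)) := Aw; rewrite !mxE => <-.
    rewrite [RHS](reindex (@enum_rank G)) /=; last by apply: onW_bij; exact: enum_rank_bij.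
    by apply: eq_bigr => y _; rewrite mxE !enum_rankK mulrC adjrC.
  move: w0; apply: contra_neqP => h; apply/rowP => i; rewrite mxE.
  have /forallNP/(_ (enum_val i)) := h; rewrite enum_valK.
  by move=> /negP; rewrite negbK => /eqP.
case=> v [Av [x vx]]; apply/eigenvalueP.
exists (\row_i v (enum_val i)); last first.
  apply/negP => /eqP/rowP/(_ (enum_rank x)); rewrite !mxE enum_rankK => h.
  by rewrite h eqxx in vx.
apply/rowP => i; rewrite !mxE -Av.
rewrite [LHS](reindex (@enum_rank G)) /=; last by apply: onW_bij; exact: enum_rank_bij.
by apply: eq_bigr => y _; rewrite !mxE !enum_rankK mulrC adjrC.
Qed.

Lemma has_ubound_spectrum (R : realType) (G : sgraph) :
  has_ubound [set a : R | eigenvalue (adjmx R G) a]%classic.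
Proof.
exists (#|G|)%:R => a /= /eigenvalue_adjmxP[v ev].
apply: (@eigenpair_le_supersolution R G a _ v (fun=> 1) ev) => // x.
rewrite mulr1 -sum1_card natr_sum; apply: ler_sum => y _.
by rewrite mulr1 adjr_le1.
Qed.

(** Should the spectrum have no real element, its supremum is 0 by convention,
    which excludes [s < lambda R G] for nonnegative [s]. *)
Lemma lambda_gt_eigenpair (R : realType) (G : sgraph) (s : R) :
  0 <= s -> s < lambda R G ->
  exists2 a, s < a & exists v : G -> R, eigenpair a v.
Proof.
move=> s0; rewrite /lambda; set E := [set a | _]%classic => sE.
have [E0|E0] := pselect (E !=set0)%classic.
  by have [a /= /eigenvalue_adjmxP ea sa] := sup_gt E0 sE; exists a.
by move: sE; rewrite sup_out ?ltNge ?s0 // => -[].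
Qed.

(** * A graph with given size and large spectral radius *)

(** Two vertices are adjacent when they form a two-element set of [E]. *)
Definition set_adj (T : finType) (E : {set {set T}}) : rel T :=
  fun x y => (x != y) && ([set x; y] \in E).

Lemma set_adj_sym (T : finType) (E : {set {set T}}) : symmetric (@set_adj T E).
Proof. by move=> x y; rewrite /set_adj eq_sym finset.setUC. Qed.

Lemma set_adj_irr (T : finType) (E : {set {set T}}) : irreflexive (@set_adj T E).
Proof. by move=> x; rewrite /set_adj eqxx. Qed.

(** The graph on [T] with this adjacency. *)
Definition set_graph (T : finType) (E : {set {set T}}) : sgraph :=
  SGraph (@set_adj_sym T E) (@set_adj_irr T E).

Lemma edges_set_graph (T : finType) (E : {set {set T}}) :
  (forall A, A \in E -> #|A| = 2) -> edges (set_graph T E) = E.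
Proof.
move=> E2; apply/setP => A; rewrite inE; apply/idP/idP.
  by case/existsP=> x /existsP[y /andP[/andP[_ xyE] /eqP->]].
move=> AE; have /eqP/cards2P[x [y [xy defA]]] := E2 _ AE.
apply/existsP; exists x; apply/existsP; exists y.
by rewrite defA eqxx /= /set_adj xy -defA AE.
Qed.

Lemma subset_of_card (T : finType) (A : {set T}) (r : nat) :
  (r <= #|A|)%N -> exists2 B : {set T}, B \subset A & #|B| = r.
Proof.
move=> rA; exists [set x in take r (enum A)].
  by apply/fintype.subsetP => x; rewrite inE => /mem_take; rewrite mem_enum.
rewrite cardsE (card_uniqP (take_uniq _ (enum_uniq _))) size_takel //.
by rewrite -cardE.
Qed.

(** The graph is a clique on [k] vertices together with [r] edges on [k] other
    vertices; the indicator of the clique is an eigenvector for [k - 1]. *)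
Lemma clique_with_disjoint_edges (R : realType) (k r : nat) :
  (0 < k)%N -> (r <= 'C(k, 2))%N ->
  exists G : sgraph, #|edges G| = ('C(k, 2) + r)%N /\ k%:R - 1 <= lambda R G.
Proof.
move=> k0 rk; pose T : finType := ('I_k + 'I_k)%type.
pose S : {set T} := [set inl i | i : 'I_k].
pose S' : {set T} := [set inr i | i : 'I_k].
have cS : #|S| = k by rewrite card_imset ?card_ord // => i j [].
have cS' : #|S'| = k by rewrite card_imset ?card_ord // => i j [].
have dS x : x \in S -> x \in S' -> False.
  by case/imsetP => i _ -> /imsetP[].
pose pairs (B : {set T}) := [set A : {set T} | A \subset B & #|A| == 2].
have cP B : #|pairs B| = 'C(#|B|, 2) by exact: cards_draws.
have rP : (r <= #|pairs S'|)%N by rewrite cP cS'.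
have [E2 sE2 cE2] := @subset_of_card _ (pairs S') r rP.
pose E := pairs S :|: E2.
have E2S' A : A \in E2 -> A \subset S' /\ #|A| = 2.
  by move/(fintype.subsetP sE2); rewrite inE => /andP[? /eqP].
have EE : edges (set_graph T E) = E.
  apply: edges_set_graph => A; rewrite finset.in_setU => /orP[|/E2S'[] //].
  by rewrite inE => /andP[_ /eqP].
exists (set_graph T E); split.
  rewrite EE cardsU cP cS cE2 [_ :&: _](_ : _ = finset.set0) ?cards0 ?subn0 //.
  apply/setP => A; rewrite finset.in_setI finset.in_set0; apply/negP => /andP[].
  rewrite inE => /andP[AS /eqP cA] /E2S'[AS' _].
  have /card_gt0P[x xA] : (0 < #|A|)%N by rewrite cA.
  exact: (dS x (fintype.subsetP AS _ xA) (fintype.subsetP AS' _ xA)).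
have adjS (x y : T) : y \in S -> set_adj T E x y = (x \in S) && (x != y).
  move=> yS; rewrite /set_adj andbC; case: eqVneq => xy; rewrite ?andbF // !andbT.
  apply/idP/idP.
    rewrite finset.in_setU => /orP[|/E2S'[sub _]].
      by rewrite inE finset.subUset finset.sub1set => /andP[/andP[]].
    by case: (dS y yS); move: sub; rewrite finset.subUset !finset.sub1set => /andP[].
  by move=> xS; rewrite finset.in_setU inE cards2 xy finset.subUset !finset.sub1set xS yS.
apply: ub_le_sup; first exact: has_ubound_spectrum.
apply/eigenvalue_adjmxP; exists (fun x : T => (x \in S)%:R : R); split.
  move=> x; rewrite /adjr /=.
  transitivity (\sum_(y in S) (((x \in S) && (x != y))%:R : R)).
    rewrite [RHS]big_mkcond; apply: eq_bigr => y _ /=.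
    by case: ifP => yS; rewrite ?mulr0 // mulr1 adjS.
  case xS : (x \in S); last by rewrite big1 // mulr0.
  rewrite (bigD1 x) //= eqxx add0r mulr1.
  rewrite (eq_bigr (fun=> 1)); last by move=> y /andP[_]; rewrite eq_sym => ->.
  have : \sum_(y in S) 1 = k%:R :> R by rewrite sumr_const cS.
  by rewrite (bigD1 x) //= => <-; rewrite addrAC subrr add0r.
exists (inl (Ordinal k0)); rewrite (imset_f (fun i => inl i)) //.
exact: oner_neq0.
Qed.

Lemma bin2_double (n : nat) : (2 * 'C(n, 2) = n * n.-1)%N.
Proof. by rewrite -(mul_bin_diag n 1) bin1. Qed.

Lemma bin2S (n : nat) : ('C(n.+1, 2) = 'C(n, 2) + n)%N.
Proof. by rewrite binS bin1. Qed.

(** Take [k] maximal with [C(k,2) <= m]: then [m < k (k + 1) / 2 <= (k - 1)^2],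
    since [k >= 5]. *)
Lemma exists_large_lambda (R : realType) (m : nat) :
  (10 <= m)%N ->
  exists G : sgraph, #|edges G| = m /\ Num.sqrt m%:R < lambda R G.
Proof.
move=> hm.
have exk : exists k, (m < 'C(k, 2))%N by exists m.+2; rewrite bin2S; lia.
case: (ex_minnP exk) => -[|k] // hk mink.
have km : ('C(k, 2) <= m)%N.
  by rewrite leqNgt; apply/negP => /mink; rewrite ltnn.
have k5 : (5 <= k)%N.
  rewrite leqNgt; apply/negP => k5; move: hk; rewrite bin2S.
  by have := bin2_double k; move: k5; case: k {mink km} => [|[|[|[|[|k]]]]] //=; lia.
have b2 := bin2_double k.
have rk : (m - 'C(k, 2) <= 'C(k, 2))%N by move: hk; rewrite bin2S; nia.
have [G [cG lG]] := @clique_with_disjoint_edges R k _ (ltnW (ltnW (ltnW (ltnW k5)))) rk.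
exists G; split; first by rewrite cG subnKC.
apply: lt_le_trans lG.
have k1 : 0 <= k%:R - 1 :> R by rewrite subr_ge0 ler1n; lia.
rewrite -(@ltr_pXn2r _ 2) ?nnegrE ?sqrtr_ge0 // sqr_sqrtr ?ler0n //.
have -> : k%:R - 1 = k.-1%:R :> R by rewrite -subn1 natrB //; lia.
by rewrite -natrX ltr_nat; move: hk; rewrite bin2S; nia.
Qed.

(** * The lower bound *)

Lemma copies_lower_bound (R : realType) (m : nat) (G : sgraph) :
  36 / 10 * 10 ^+ 9 <= m%:R :> R -> #|edges G| = m ->
  Num.sqrt m%:R < lambda R G ->
  m%:R ^+ 2 / 2000 <= (copies (cycle_graph 4) G)%:R :> R.
Proof.
move=> hm eG hl.
have [a sa [v ev]] := @lambda_gt_eigenpair R G _ (sqrtr_ge0 _) hl.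
set s := Num.sqrt m%:R in sa.
have s0 : 0 <= s by exact: sqrtr_ge0.
have sE : s ^+ 2 = m%:R by rewrite sqr_sqrtr ?ler0n.
have s10 : 10 <= s.
  rewrite -(@ler_pXn2r _ 2) ?nnegrE // sE; apply: le_trans hm; lra.
have hdeg : \sum_(x : G) degr R x <= 2 * m%:R by rewrite -eG sum_degr_le.
have dmax (u : G) : degr R u <= 4 / 5 * m%:R.
  rewrite leNgt; apply/negP => hu.
  by have := @dominant_vertex_bound R G a m%:R s v u s10 sE ev hdeg hu; rewrite leNgt sa.
have ma : m%:R < a ^+ 2 by rewrite -sE; nra.
have := labelled_C4_lower_bound R G a m%:R v hm ma ev hdeg dmax.
by have := labelled_C4_le_copies R G; lra.
Qed.

Theorem theorem3 (R : realType) (m : nat)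
    (hm : 36 / 10 * 10 ^+ 9 <= m%:R :> R) :
  (forall G : sgraph,
      #|edges G| = m ->
      Num.sqrt m%:R < lambda R G ->
      m%:R ^+ 2 / 2000 <= (copies (cycle_graph 4) G)%:R :> R
      \/ star_with_isolated G)
  /\ m%:R ^+ 2 / 2000 <= f R m.
Proof.
split=> [G eG hl|]; first by left; exact: copies_lower_bound hl.
apply: lb_le_inf; last by move=> _ [G [eG hl ->]]; exact: copies_lower_bound hl.
have m10 : (10 <= m)%N by rewrite -(ler_nat R); lra.
have [G [eG hl]] := @exists_large_lambda R m m10.
by exists (copies (cycle_graph 4) G)%:R, G.
Qed.
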